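(* Let $A$ be a Noetherian commutative ring, let $I \subseteq A$ be any ideal and let $s$ be a positive integer. Set $$K = \bigcap_{\mathfrak{p} \in \operatorname{Ass}_A^*(I) \setminus \operatorname{Min}_A(I)} \mathfrak{p} \quad\text{ and }\quad K_s = \bigcap_{\mathfrak{p} \in \operatorname{Ass}_A(I^s) \setminus \operatorname{Min}_A(I)} \mathfrak{p}.$$ Let $x \in K$ be any element that is regular on $A/\sqrt{I}$ if $\operatorname{Ass}_A^*(I) \setminus \operatorname{Min}_A(I)\neq \emptyset$, and $x = 1$ otherwise. Then $${}^{\mathtt m}I^{(s)} = I^{(s)}_K = I^{(s)}_{K_s} = I^{(s)}_{(x)}.$$ In particular, given an arbitrary irredundant primary decomposition of $I^s$, ${}^{\mathtt m}I^{(s)}$ is the intersection of its components that are primary to elements of $\operatorname{Min}_A(I)$.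
   Context: For an ideal $I$ of a Noetherian commutative ring $A$: $\operatorname{Ass}_A(I)$ denotes the set of associated primes of $A/I$; $\operatorname{Min}_A(I)$ denotes the set of minimal primes of $I$; $\operatorname{Ass}_A^*(I) = \bigcup_{n=1}^\infty \operatorname{Ass}_A(I^n)$, which is a finite set. An empty intersection of ideals of $A$ is $A$. The $s$-th symbolic power defined by minimal primes is ${}^{\mathtt m}I^{(s)} = \bigcap_{\mathfrak{p} \in \operatorname{Min}_A(I)} (I^sA_{\mathfrak{p}} \cap A)$, where $\cap\, A$ means preimage under $A\to A_{\mathfrak{p}}$. For an ideal $K$ of $A$, the $s$-th saturated power of $I$ with respect to $K$ is $I^{(s)}_K = I^s : K^\infty = \bigcup_{t\ge 1}(I^s : K^t)$. *)

(* Defs.v *)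
From HB Require Import structures.
From mathcomp Require Import all_boot all_algebra generic_quotient.
From mathcomp Require Import boolp classical_sets.
From mathcomp Require Import ring.

Set Implicit Arguments.
Unset Strict Implicit.
Unset Printing Implicit Defensive.

Import GRing.Theory.
Local Open Scope classical_set_scope.
Local Open Scope ring_scope.

(* Ideals are classical sets, and rings are [comPzRingType]s, so that the unit
   ideal and the zero ring are allowed ([idealr] of ring_quotient only covers
   proper ideals of nonzero rings). *)

Definition ideal (A : comPzRingType) (I : set A) : Prop :=
  [/\ I 0, forall a b, I a -> I b -> I (a + b) & forall a b, I b -> I (a * b)].

Definition ideal_gen (A : comPzRingType) (X : set A) : set A :=
  smallest (@ideal A) X.

Definition noetherian (A : comPzRingType) : Prop :=
  forall I : set A, ideal I ->
    exists X : seq A, I = ideal_gen [set a | a \in X].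

Definition ideal_mul (A : comPzRingType) (I J : set A) : set A :=
  ideal_gen [set a * b | a in I & b in J].

Definition ideal_pow (A : comPzRingType) (I : set A) (n : nat) : set A :=
  iter n (ideal_mul I) setT.

Definition colon (A : comPzRingType) (I J : set A) : set A :=
  [set a | forall b, J b -> I (a * b)].

Definition radical (A : comPzRingType) (I : set A) : set A :=
  [set a | exists n, I (a ^+ n)].

Definition prime_ideal (A : comPzRingType) (p : set A) : Prop :=
  [/\ ideal p, ~ p 1 & forall a b, p (a * b) -> p a \/ p b].

Definition primary_ideal (A : comPzRingType) (Q : set A) : Prop :=
  [/\ ideal Q, ~ Q 1 & forall a b, Q (a * b) -> Q a \/ radical Q b].

Definition spec (A : comPzRingType) : Type := {p : set A | prime_ideal p}.

Definition prime_set (A : comPzRingType) (p : spec A) : set A := sval p.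
Coercion prime_set : spec >-> set.

(* [x] is a nonzerodivisor on A/I; an element vanishes in A/I when it lies
   in I. *)
Definition regular_mod (A : comPzRingType) (I : set A) (x : A) : Prop :=
  forall a, I (x * a) -> I a.

(* The primes of the form Ann_A(y + I), for y + I in A/I. *)
Definition Ass (A : comPzRingType) (I : set A) : set (spec A) :=
  [set p | exists y : A, p = [set a | I (a * y)] :> set A].

Definition Ass_star (A : comPzRingType) (I : set A) : set (spec A) :=
  \bigcup_(n in [set n | (0 < n)%N]) Ass (ideal_pow I n).

Definition Min (A : comPzRingType) (I : set A) : set (spec A) :=
  [set p | I `<=` p /\
     forall q : spec A, I `<=` q -> (q : set A) `<=` p -> q = p :> set A].

Section Localization.
Variables (A : comPzRingType) (p : spec A).

Lemma den1 : 1 \notin (p : set A).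
Proof. by case: p => q [? ? ?]; apply/negP; rewrite inE. Qed.

Lemma denM t u : t \notin (p : set A) -> u \notin (p : set A) ->
  t * u \notin (p : set A).
Proof.
case: p => q [iq q1 qM] /= /negP tq /negP uq.
by apply/negP; rewrite inE => /qM[] h; [apply: tq | apply: uq]; rewrite inE.
Qed.

Definition loc_frac := {x : A * A | x.2 \notin (p : set A)}.

Definition mkfrac (a t : A) (ht : t \notin (p : set A)) : loc_frac :=
  exist _ (a, t) ht.

Definition loc_equiv (x y : loc_frac) : bool :=
  `[< exists2 u : A, u \notin (p : set A) &
        u * ((val x).1 * (val y).2) = u * ((val y).1 * (val x).2) >].

Lemma loc_equiv_refl : reflexive loc_equiv.
Proof. by move=> x; apply/asboolP; exists 1 => //; exact: den1. Qed.

Lemma loc_equiv_sym : symmetric loc_equiv.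
Proof. by move=> x y; apply/asboolP/asboolP => -[u hu e]; exists u. Qed.

Lemma loc_equiv_trans : transitive loc_equiv.
Proof.
move=> [[b t] /= ht] [[a s] /= hs] [[c r] /= hr].
move=> /asboolP[/= u hu e1] /asboolP[/= v hv e2]; apply/asboolP => /=.
exists (u * v * t); first by rewrite !denM.
have -> : u * v * t * (a * r) = v * r * (u * (a * t)) by ring.
rewrite e1; have -> : v * r * (u * (b * s)) = u * s * (v * (b * r)) by ring.
by rewrite e2; ring.
Qed.

Canonical loc_equiv_equiv :=
  EquivRel loc_equiv loc_equiv_refl loc_equiv_sym loc_equiv_trans.

Definition localization := {eq_quot loc_equiv}%qT.

HB.instance Definition _ : EqQuotient _ loc_equiv localization :=
  EqQuotient.on localization.
HB.instance Definition _ := Choice.on localization.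

Local Notation pi := (\pi_localization)%qT.

Lemma loc_piP (x y : loc_frac) :
  reflect (exists2 u : A, u \notin (p : set A) &
             u * ((val x).1 * (val y).2) = u * ((val y).1 * (val x).2))
          (pi x == pi y).
Proof. by rewrite eqmodE; apply: asboolP. Qed.

Definition addl_frac (x y : loc_frac) : loc_frac :=
  mkfrac ((val x).1 * (val y).2 + (val y).1 * (val x).2)
         (denM (valP x) (valP y)).
Definition oppl_frac (x : loc_frac) : loc_frac := mkfrac (- (val x).1) (valP x).
Definition mull_frac (x y : loc_frac) : loc_frac :=
  mkfrac ((val x).1 * (val y).1) (denM (valP x) (valP y)).

Definition loc_add := lift_op2 localization addl_frac.
Definition loc_opp := lift_op1 localization oppl_frac.
Definition loc_mul := lift_op2 localization mull_frac.

Definition to_loc (a : A) : localization := pi (mkfrac a den1).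

Lemma loc_reprP (x : loc_frac) : exists2 u : A, u \notin (p : set A) &
  u * ((val (repr (pi x))).1 * (val x).2) =
  u * ((val x).1 * (val (repr (pi x))).2).
Proof. by apply/loc_piP; rewrite reprK. Qed.

Lemma loc_addE x y : loc_add (pi x) (pi y) = pi (addl_frac x y).
Proof.
unlock loc_add; apply/eqP/loc_piP; have [u hu e1] := loc_reprP x.
have [v hv e2] := loc_reprP y.
exists (u * v); first exact: denM.
move: (repr (pi x)) (repr (pi y)) e1 e2 => [[a s] /= _] [[b t] /= _].
case: x y => [[a' s'] /= _] [[b' t'] /= _] e1 e2.
transitivity (v * t * t' * (u * (a * s')) + u * s * s' * (v * (b * t'))).
  by ring.
by rewrite e1 e2; ring.
Qed.

Lemma loc_oppE x : loc_opp (pi x) = pi (oppl_frac x).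
Proof.
unlock loc_opp; apply/eqP/loc_piP; have [u hu e] := loc_reprP x.
by exists u => //=; rewrite !mulNr !mulrN e.
Qed.

Lemma loc_mulE x y : loc_mul (pi x) (pi y) = pi (mull_frac x y).
Proof.
unlock loc_mul; apply/eqP/loc_piP; have [u hu e1] := loc_reprP x.
have [v hv e2] := loc_reprP y.
exists (u * v); first exact: denM.
move: (repr (pi x)) (repr (pi y)) e1 e2 => [[a s] /= _] [[b t] /= _].
case: x y => [[a' s'] /= _] [[b' t'] /= _] e1 e2.
transitivity ((u * (a * s')) * (v * (b * t'))); first by ring.
by rewrite e1 e2; ring.
Qed.

Ltac loc_ring :=
  rewrite /to_loc ?(loc_addE, loc_oppE, loc_mulE);
  apply/eqP/loc_piP; exists 1; [exact: den1 | rewrite /=; ring].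

Lemma loc_addA : associative loc_add.
Proof. by elim/quotW=> x; elim/quotW=> y; elim/quotW=> z; loc_ring. Qed.

Lemma loc_addC : commutative loc_add.
Proof. by elim/quotW=> x; elim/quotW=> y; loc_ring. Qed.

Lemma loc_add0 : left_id (to_loc 0) loc_add.
Proof. by elim/quotW=> x; loc_ring. Qed.

Lemma loc_addN : left_inverse (to_loc 0) loc_opp loc_add.
Proof. by elim/quotW=> x; loc_ring. Qed.

HB.instance Definition _ :=
  GRing.isZmodule.Build localization loc_addA loc_addC loc_add0 loc_addN.

Lemma loc_mulA : associative loc_mul.
Proof. by elim/quotW=> x; elim/quotW=> y; elim/quotW=> z; loc_ring. Qed.

Lemma loc_mulC : commutative loc_mul.
Proof. by elim/quotW=> x; elim/quotW=> y; loc_ring. Qed.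

Lemma loc_mul1 : left_id (to_loc 1) loc_mul.
Proof. by elim/quotW=> x; loc_ring. Qed.

Lemma loc_mulDl : left_distributive loc_mul loc_add.
Proof. by elim/quotW=> x; elim/quotW=> y; elim/quotW=> z; loc_ring. Qed.

HB.instance Definition _ := GRing.Zmodule_isComPzRing.Build localization
  loc_mulA loc_mulC loc_mul1 loc_mulDl.

Lemma to_loc_is_zmod_morphism : zmod_morphism to_loc.
Proof.
move=> a b; change (to_loc (a - b) = loc_add (to_loc a) (loc_opp (to_loc b))).
by loc_ring.
Qed.

HB.instance Definition _ :=
  GRing.isZmodMorphism.Build A localization to_loc to_loc_is_zmod_morphism.

Lemma to_loc_is_monoid_morphism : monoid_morphism to_loc.
Proof.
split=> // a b; change (to_loc (a * b) = loc_mul (to_loc a) (to_loc b)).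
by loc_ring.
Qed.

HB.instance Definition _ :=
  GRing.isMonoidMorphism.Build A localization to_loc to_loc_is_monoid_morphism.

(* J A_p `&` A: the preimage under A -> A_p of the extension of J. *)
Definition loc_contr (J : set A) : set A :=
  to_loc @^-1` ideal_gen (to_loc @` J).

End Localization.

(* [\bigcap] over an empty family is [setT], the unit ideal. *)
Definition min_symb_pow (A : comPzRingType) (I : set A) (s : nat) : set A :=
  \bigcap_(p in Min I) loc_contr p (ideal_pow I s).

Definition sat_pow (A : comPzRingType) (I : set A) (s : nat) (K : set A) :
    set A :=
  \bigcup_(t in [set t | (0 < t)%N]) colon (ideal_pow I s) (ideal_pow K t).

(* Irredundancy only asks that no component can be omitted; the radicals of
   the components need not be distinct. *)
Definition irredundant_primary_decomp (A : comPzRingType) (J : set A)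
    (n : nat) (Q : 'I_n -> set A) : Prop :=
  [/\ forall i, primary_ideal (Q i),
      J = \bigcap_i Q i &
      forall i, J <> \bigcap_(j in [set j | j != i]) Q j].

(* Main.v *)
From HB Require Import structures.
Require Import Defs.
From mathcomp Require Import all_boot all_algebra.
From mathcomp Require Import boolp classical_sets.
From mathcomp Require Import ring.

Set Implicit Arguments.
Unset Strict Implicit.
Unset Printing Implicit Defensive.

Import GRing.Theory.
Local Open Scope classical_set_scope.
Local Open Scope ring_scope.

(** Write J = I^s and let M be the symbolic power on the left. Since JA_p
    contracts to the elements a with ua in J for some u outside p
    ([loc_contrP]), an element a lies in M iff for every p minimal over I some
    u outside p satisfies ua in J. The equalities follow from the inclusions
    M <= J : Ks^oo <= J : K^oo <= M, the middle one because K <= Ks.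

    For the first inclusion, let a be in M and f in Ks. If no power of f killed
    a modulo J, then among the ideals (J : ba) disjoint from the powers of f a
    maximal one would be an associated prime q of J ([ann_prime_avoiding]).
    As f is not in q, q is minimal over I, and then some u outside q has ua in
    J, so u is in (J : ba) = q, a contradiction. Hence Ks lies in the radical
    of (J : a), and so does a power of Ks in (J : a), because Ks is finitely
    generated ([sub_radical_pow]).

    For the last inclusion K must not be contained in any p minimal over I
    ([asymptotic_notin_Min]). No single prime of Ass*(I) \ Min(I) is contained
    in p, so it is enough that Ass*(I) is finite ([Ass_star_finite]). The
    primes of Ass(A/I^n) are annihilators of elements of I^k/I^(k+1), k < n;
    these are contracted from associated primes of the associated graded ring
    of I, a quotient of a polynomial ring S in finitely many variables over A.
    The ring S is noetherian by the Hilbert basis theorem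
    ([noetherian_poly]), so each of its ideals has finitely many associated
    primes ([ann_primes_finite]).

    An x regular modulo the radical of I lies in no p minimal over I
    ([regular_notin_Min]), so J : x^oo <= M, and x is in K <= Ks. Finally, a
    component of J with radical p minimal over I contains M, since u outside p
    and ua in J force a into it; conversely, the components whose radical is
    not minimal have an element u outside p in common, and u multiplies the
    intersection of the other components into J ([min_symb_pow_decomp]). *)

(** * Ideals and their powers *)

Section Ideals.
Variable A : comPzRingType.
Implicit Types (I J K N p : set A) (a b x y : A).

Lemma ideal0 J : ideal J -> J 0. Proof. by case. Qed.

Lemma idealD J a b : ideal J -> J a -> J b -> J (a + b).
Proof. by case=> _ + _; apply. Qed.

Lemma idealMl J a b : ideal J -> J b -> J (a * b).
Proof. by case=> _ _; apply. Qed.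

Lemma idealMr J a b : ideal J -> J a -> J (a * b).
Proof. by move=> idJ Ja; rewrite mulrC; exact: idealMl. Qed.

Lemma idealB J a b : ideal J -> J a -> J b -> J (a - b).
Proof.
by move=> idJ Ja Jb; apply: idealD => //; rewrite -mulN1r; apply: idealMl.
Qed.

Lemma ideal_sum J (T : Type) (r : seq T) (P : pred T) (F : T -> A) :
  ideal J -> (forall i, P i -> J (F i)) -> J (\sum_(i <- r | P i) F i).
Proof.
move=> idJ JF; apply: (big_ind J) => //; first exact: ideal0.
by move=> a b; apply: idealD.
Qed.

Lemma idealT : ideal [set: A]. Proof. by []. Qed.

Lemma ideal_gen_ideal (X : set A) : ideal (ideal_gen X).
Proof.
split=> [J [idJ _]|a b Xa Xb J [idJ XJ]|a b Xb J [idJ XJ]]; first exact: ideal0.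
  by apply: idealD => //; [apply: Xa | apply: Xb].
by apply: idealMl => //; apply: Xb.
Qed.

Lemma sub_ideal_gen (X : set A) : X `<=` ideal_gen X.
Proof. exact: sub_gen_smallest. Qed.

Lemma ideal_gen_sub (X J : set A) :
  ideal J -> X `<=` J -> ideal_gen X `<=` J.
Proof. exact: smallest_sub. Qed.

Lemma ideal_gen_mono (X Y : set A) : X `<=` Y -> ideal_gen X `<=` ideal_gen Y.
Proof.
move=> XY; apply: ideal_gen_sub; first exact: ideal_gen_ideal.
by move=> a /XY; apply: sub_ideal_gen.
Qed.

(** [adjoin J x] is the ideal J + (x). *)
Definition adjoin J x : set A := [set a | exists r b, J b /\ a = r * x + b].

Lemma adjoin_ideal J x : ideal J -> ideal (adjoin J x).
Proof.
move=> idJ; split=> [|_ _ [r [b [Jb ->]]] [s [c [Jc ->]]]|a _ [r [b [Jb ->]]]].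
- by exists 0, 0; split; [exact: ideal0 | ring].
- by exists (r + s), (b + c); split; [exact: idealD | ring].
- by exists (a * r), (a * b); split; [exact: idealMl | ring].
Qed.

Lemma sub_adjoin J x : J `<=` adjoin J x.
Proof. by move=> a Ja; exists 0, a; split=> //; rewrite mul0r add0r. Qed.

Lemma mem_adjoin J x : ideal J -> adjoin J x x.
Proof.
by move=> idJ; exists 1, 0; split; [exact: ideal0 | rewrite mul1r addr0].
Qed.

Lemma ideal_gen_cons x (X : seq A) :
  ideal_gen [set a | a \in x :: X] `<=`
  adjoin (ideal_gen [set a | a \in X]) x.
Proof.
have idX := ideal_gen_ideal [set a | a \in X].
apply: ideal_gen_sub; first exact: adjoin_ideal.
move=> a; rewrite /= inE => /orP[/eqP ->|aX]; first exact: mem_adjoin.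
by apply: sub_adjoin; apply: sub_ideal_gen.
Qed.

(** [ann J y] is the ideal (J : y), the annihilator of the class of y
    modulo J. *)
Definition ann J y : set A := [set a | J (a * y)].

Lemma ann_ideal J y : ideal J -> ideal (ann J y).
Proof.
move=> idJ; split=> [|a b|a b] /=; rewrite /ann /=.
- by rewrite mul0r; apply: ideal0.
- by rewrite mulrDl; apply: idealD.
- by rewrite -mulrA; apply: idealMl.
Qed.

Lemma ideal_pow_ideal I n : ideal (ideal_pow I n).
Proof. by case: n => [|n]; [exact: idealT | exact: ideal_gen_ideal]. Qed.

Lemma ideal_powS I n a b :
  I a -> ideal_pow I n b -> ideal_pow I n.+1 (a * b).
Proof. by move=> Ia Ib; apply: sub_ideal_gen; exists a => //; exists b. Qed.

Lemma ideal_powS_sub I n J : ideal J ->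
  (forall a b, I a -> ideal_pow I n b -> J (a * b)) -> ideal_pow I n.+1 `<=` J.
Proof.
by move=> idJ h; apply: ideal_gen_sub => // _ [a Ia [b Ib <-]]; apply: h.
Qed.

Lemma ideal_powD I m n a b :
  ideal_pow I m a -> ideal_pow I n b -> ideal_pow I (m + n) (a * b).
Proof.
move=> + Ib; elim: m a => [|m IH] a.
  by move=> _; rewrite add0n; apply: idealMl => //; exact: ideal_pow_ideal.
suff : ideal_pow I m.+1 `<=` ann (ideal_pow I (m.+1 + n)) b by apply.
apply: ideal_powS_sub; first exact/ann_ideal/ideal_pow_ideal.
move=> c d Ic Id; change (ideal_pow I (m + n).+1 (c * d * b)).
by rewrite -mulrA; apply: ideal_powS => //; apply: IH.
Qed.

Lemma ideal_powX I t a : I a -> ideal_pow I t (a ^+ t).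
Proof.
by move=> Ia; elim: t => // t IH; rewrite exprS; apply: ideal_powS.
Qed.

Lemma ideal_powS_le I n : ideal_pow I n.+1 `<=` ideal_pow I n.
Proof.
apply: ideal_powS_sub => [|a b _]; first exact: ideal_pow_ideal.
by apply: idealMl; apply: ideal_pow_ideal.
Qed.

Lemma ideal_pow_le I n : ideal I -> (0 < n)%N -> ideal_pow I n `<=` I.
Proof.
case: n => // n idI _; apply: ideal_powS_sub => // a b Ia _.
exact: idealMr.
Qed.

Lemma ideal_pow_mono I J n : I `<=` J -> ideal_pow I n `<=` ideal_pow J n.
Proof.
move=> IJ; elim: n => // n IH; apply: ideal_powS_sub => [|a b Ia Ib].
  exact: ideal_pow_ideal.
by apply: ideal_powS; [exact: IJ | exact: IH].
Qed.

(** The exponents are lowered one at a time: a product (rx + b)c with b in J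
    lies in N because c lies in (N : rx), which contains x^(n-1), and in
    (N : b), which contains the (t-1)-st power of J. *)
Lemma adjoin_pow J x t n N : ideal N ->
  ideal_pow J t `<=` N -> N (x ^+ n) -> ideal_pow (adjoin J x) (t + n) `<=` N.
Proof.
move: {2}(t + n)%N (leqnn (t + n)) => k; elim: k t n N => [|k IH] t n N le idN.
  case: t n le => [|t] [|n] //= _ JN _; exact: JN.
case: t le => [|t] le JN xN.
  by move=> a _; rewrite -[a]mulr1; apply: idealMl => //; apply: JN.
case: n xN le => [|n] xN le.
  by move=> a _; rewrite -[a]mulr1; apply: idealMl.
rewrite addSn; apply: ideal_powS_sub => // _ c [r [b [Jb ->]]] Ic.
rewrite mulrDl; apply: idealD => //.
  suff : ann N (r * x) c by rewrite /ann /= mulrC.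
  move: c Ic; rewrite addnS -addSn; apply: IH;
    last by rewrite /ann /= mulrCA -exprSr; apply: idealMl.
  - by rewrite -ltnS -addnS.
  - exact: ann_ideal.
  - by move=> c /JN; apply: idealMr.
suff : ann N b c by rewrite /ann /= mulrC.
move: c Ic; apply: IH => //; last by apply: idealMr.
- exact: ann_ideal.
- by move=> c Jc; apply: JN; rewrite mulrC; apply: ideal_powS.
Qed.

(** An ideal of a noetherian ring contained in the radical of N has a power
    contained in N. *)
Lemma sub_radical_pow N K : noetherian A -> ideal N -> ideal K ->
  K `<=` radical N -> exists t, ideal_pow K t `<=` N.
Proof.
move=> noeA idN /noeA[X ->] XN.
have {XN}: forall x, x \in X -> radical N x.
  by move=> x xX; apply: XN; apply: sub_ideal_gen.
elim: X => [|x X IH] radX.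
  exists 1%N; apply: subset_trans (ideal_pow_le _ _) _ => //.
    exact: ideal_gen_ideal.
  by apply: ideal_gen_sub.
have [|t tN] := IH; first by move=> y yX; apply: radX; rewrite inE yX orbT.
have [n xN] := radX x (mem_head _ _).
exists (t + n)%N; apply: subset_trans (adjoin_pow idN tN xN).
exact/ideal_pow_mono/ideal_gen_cons.
Qed.

End Ideals.

(** * Noetherian rings and annihilator primes *)

Section Noetherian.
Variable A : comPzRingType.
Hypothesis noeA : noetherian A.
Implicit Types (I J K N p q : set A) (a b x y : A).

(** Every nonempty set F of ideals has a maximal element. *)
Lemma noetherian_max (F : set (set A)) N0 :
  (forall N, F N -> ideal N) -> F N0 ->
  exists2 N, F N & forall N', F N' -> N `<=` N' -> N' `<=` N.
Proof.
move=> idF FN0; apply: contrapT => noM.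
have step (N : {N | F N}) :
    {N' : {N | F N} | sval N `<=` sval N' /\ ~ sval N' `<=` sval N}.
  apply: cid; case: N => N FN /=; apply: contrapT => noN; apply: noM.
  exists N => // N' FN' NN'; apply: contrapT => N'N; apply: noN.
  by exists (exist _ N' FN').
have [f [_ fP]] := dependent_choice step (exist _ N0 FN0).
have fmono m n : (m <= n)%N -> sval (f m) `<=` sval (f n).
  elim: n => [|n IH]; first by rewrite leqn0 => /eqP ->.
  rewrite leq_eqVlt => /orP[/eqP -> //|/IH]; move/subset_trans; apply.
  by have [] := fP n.
have idf n : ideal (sval (f n)) by apply: idF; exact: (svalP (f n)).
pose U : set A := \bigcup_n sval (f n).
have idU : ideal U.
  split=> [|a b [m _ fa] [n _ fb]|a b [m _ fb]].
    by exists 0%N; last apply: ideal0.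
    exists (m + n)%N => //; apply: idealD => //.
      exact: (fmono m _ (leq_addr _ _)).
    exact: (fmono n _ (leq_addl _ _)).
  by exists m => //; apply: idealMl.
have [X UX] := noeA idU.
have [n Xn] : exists n, forall x, x \in X -> sval (f n) x.
  have: forall x, x \in X -> U x.
    by move=> x xX; rewrite UX; apply: sub_ideal_gen.
  elim: X {UX} => [|x X IH] XU; first by exists 0%N.
  have [|n Xn] := IH; first by move=> y yX; apply: XU; rewrite inE yX orbT.
  have [m _ xm] := XU x (mem_head _ _).
  exists (m + n)%N => y; rewrite inE => /orP[/eqP ->|/Xn yn].
    exact: (fmono m _ (leq_addr _ _)).
  exact: (fmono n _ (leq_addl _ _)).
have [_] := fP n; apply=> a fa.
have : U a by exists n.+1.
by rewrite UX; apply: ideal_gen_sub.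
Qed.

(** If no element of the multiplicative set T multiplies a into J, then J has
    an associated prime that is the annihilator of a multiple of a and that
    avoids T: a maximal element among the ideals (J : ba) avoiding T. *)
Lemma ann_prime_avoiding J (T : set A) a : ideal J -> T 1 ->
  (forall t u, T t -> T u -> T (t * u)) -> (forall t, T t -> ~ J (t * a)) ->
  exists b, prime_ideal (ann J (b * a)) /\
            forall t, T t -> ~ ann J (b * a) t.
Proof.
move=> idJ T1 TM Ta.
pose good b := forall t, T t -> ~ J (t * (b * a)).
have [||_ [b gb ->] bmax] :=
    @noetherian_max [set N | exists2 b, good b & N = ann J (b * a)]
                    (ann J (1 * a)).
- by move=> _ [b _ ->]; apply: ann_ideal.
- by exists 1 => // t; rewrite mul1r; apply: Ta.
have maxP c : good (c * b) -> ann J (c * (b * a)) `<=` ann J (b * a).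
  move=> gc; rewrite mulrA; apply: bmax; first by exists (c * b).
  by move=> d Jd; rewrite /ann /= -mulrA mulrCA; apply: idealMl.
exists b; split; last exact: gb.
split; [exact: ann_ideal | by apply: gb|].
move=> c d; rewrite /ann /= => Jcd; have [Jd|nJd] := pselect (J (d * (b * a))).
  by right.
left; apply: (maxP d); last by rewrite /ann /= mulrA.
move=> t Tt Jt; apply: nJd; apply: (maxP t); last first.
  by rewrite /ann /= mulrCA -[b * a]mul1r; move: Jt; congr (J _); ring.
move=> u Tu; have -> : u * (t * b * a) = (u * t) * (b * a) by ring.
exact: (gb _ (TM _ _ Tu Tt)).
Qed.

(** For J contained in J', an associated prime of J comes either from J'/J or
    from A/J'. *)
Lemma ann_prime_split J J' y : ideal J -> J `<=` J' -> prime_ideal (ann J y) ->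
  (exists a, J' (a * y) /\ ann J y = ann J (a * y)) \/ ann J y = ann J' y.
Proof.
move=> idJ JJ' [_ _ pr].
have [[a J'a nJa]|no] := pselect (exists2 a, J' (a * y) & ~ J (a * y)).
  left; exists a; split=> //; apply/seteqP; split=> b.
    by rewrite /ann /= mulrCA => Jb; apply: idealMl.
  by rewrite /ann /= mulrA => /pr[].
right; apply/seteqP; split=> b; first exact: JJ'.
by move=> J'b; apply: contrapT => nJb; apply: no; exists b.
Qed.

(** Finiteness of the set of associated primes, by noetherian induction: when
    bc is in J but neither b nor c is, the associated primes of J are among
    those of (J : b) and of J + (b). *)
Lemma ann_primes_finite J : ideal J ->
  exists Ps : seq (set A), forall y, prime_ideal (ann J y) -> ann J y \in Ps.
Proof.
move=> idJ; apply: contrapT => infJ.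
have [||N [idN infN] Nmax] := @noetherian_max [set N | ideal N /\ ~ exists
    Ps : seq (set A), forall y, prime_ideal (ann N y) -> ann N y \in Ps] J.
- by move=> N [].
- by split.
have grow N' b : ideal N' -> N `<=` N' -> N' b -> ~ N b -> exists
    Ps : seq (set A), forall y, prime_ideal (ann N' y) -> ann N' y \in Ps.
  move=> idN' NN' N'b nNb; apply: contrapT => infN'; apply: nNb.
  by apply: (Nmax N').
apply: infN.
(* When no such b and c exist, N is prime or the unit ideal, and no
   annihilator prime of N other than N itself is possible. *)
have [[b [c [Nbc nNb nNc]]]|prN] :=
    pselect (exists b c, [/\ N (b * c), ~ N b & ~ N c]); last first.
  exists [:: N] => y [_ n1 _]; rewrite inE; apply/eqP/seteqP; split=> a.
    move=> Na; apply: contrapT => nNa; apply: prN; exists a, y; split=> //.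
    by move=> Ny; apply: n1; rewrite /ann /= mul1r.
  exact: idealMr.
have [||||Ps1 P1] := grow (ann N b) c.
- exact: ann_ideal.
- by move=> a; apply: idealMr.
- by rewrite /ann /= mulrC.
- by [].
have [||||Ps2 P2] := grow (adjoin N b) b.
- exact: adjoin_ideal.
- exact: sub_adjoin.
- exact: mem_adjoin.
- by [].
exists (Ps1 ++ Ps2) => y py; rewrite mem_cat; apply/orP.
have [[a [[r [d [Nd E]]] e]]|e] := ann_prime_split idN (@sub_adjoin _ N b) py.
  (* Modulo N, the multiple of y lying in N + (b) is rb, and
     (N : rb) = ((N : b) : r). *)
  left; have e' : ann N y = ann (ann N b) r.
    rewrite e E; apply/seteqP; split=> u; rewrite /ann /= mulrDr mulrA.
      move=> h; rewrite -[X in N X](addrK (u * d)); apply: idealB => //.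
      exact: idealMl.
    by move=> h; apply: idealD => //; apply: idealMl.
  by rewrite e'; apply: P1; rewrite -e'.
by right; rewrite e; apply: P2; rewrite -e.
Qed.

End Noetherian.

(** * The basis theorem *)

Section HilbertBasis.
Variable S : comNzRingType.
Implicit Types (J : set {poly S}) (f g : {poly S}).

(** The ideal of the coefficients of degree m of the elements of J of degree
    at most m. *)
Definition lead_ideal J (m : nat) : set S :=
  [set c | exists f, [/\ J f, (size f <= m.+1)%N & f`_m = c]].

Lemma lead_ideal_ideal J m : ideal J -> ideal (lead_ideal J m).
Proof.
move=> idJ; split.
- by exists 0; rewrite size_poly0 coef0; split=> //; apply: ideal0.
- move=> _ _ [f [Jf sf <-]] [g [Jg sg <-]]; exists (f + g); split.
  + exact: idealD.
  + by rewrite (leq_trans (size_polyD _ _)) // geq_max sf.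
  + by rewrite coefD.
- move=> a _ [f [Jf sf <-]]; exists (a%:P * f); split.
  + exact: idealMl.
  + by rewrite mul_polyC (leq_trans (size_scale_leq _ _)).
  + by rewrite coefCM.
Qed.

Lemma lead_ideal_le J m n : ideal J -> (m <= n)%N ->
  lead_ideal J m `<=` lead_ideal J n.
Proof.
move=> idJ /subnKC <- c [f [Jf sf <-]]; exists (f * 'X^(n - m)); split.
- exact: idealMr.
- rewrite (leq_trans (size_polyMleq _ _)) // size_polyXn addnS /= -addSn.
  by rewrite leq_add2r.
- by rewrite coefMXn ltnNge leq_addl /= addnK.
Qed.

Lemma lead_ideal_mono J J' m : J `<=` J' -> lead_ideal J m `<=` lead_ideal J' m.
Proof. by move=> JJ' c [f [/JJ' Jf sf fc]]; exists f. Qed.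

(** An ideal is determined by its ideals of leading coefficients, and only
    finitely many of these matter once they have become stationary. *)
Lemma sub_of_lead_ideal J J' D : ideal J -> ideal J' -> J' `<=` J ->
  (forall m, (m <= D)%N -> lead_ideal J m `<=` lead_ideal J' m) ->
  (forall m, lead_ideal J m `<=` lead_ideal J D) -> J `<=` J'.
Proof.
move=> idJ idJ' J'J leD stat f.
have [k] := ubnP (size f); elim: k f => // k IH f sf Jf.
case Ef : (size f) => [|d].
  move/eqP: Ef; rewrite size_poly_eq0 => /eqP ->; exact: (ideal0 idJ').
have : lead_ideal J d f`_d by exists f; rewrite Ef.
move=> Ld; have {Ld} : lead_ideal J' d f`_d.
  have [/leD|/ltnW Dd] := leqP d D; first exact.
  by apply: (lead_ideal_le idJ' Dd); apply: leD => //; apply: (stat d).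
move=> [g [J'g sg gd]]; rewrite -[f](subrK g); apply: idealD => //.
apply: IH; last by apply: idealB => //; apply: J'J.
suff sd : (size (f - g)%R <= d)%N by rewrite (leq_ltn_trans sd) // -Ef.
apply/leq_sizeP => j; rewrite leq_eqVlt coefB.
case/orP=> [/eqP <-|dj]; first by rewrite gd subrr.
by rewrite !nth_default ?subrr ?Ef // (leq_trans sg).
Qed.

Lemma lead_ideal_generators J (X : seq S) m : ideal J ->
  (forall c, c \in X -> lead_ideal J m c) -> exists2 G : seq {poly S},
    (forall g, g \in G -> J g) &
    forall c, c \in X -> lead_ideal (ideal_gen [set g | g \in G]) m c.
Proof.
move=> idJ; elim: X => [|x X IH] XJ; first by exists [::].
have [|G GJ XG] := IH; first by move=> c cX; apply: XJ; rewrite inE cX orbT.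
have [f [Jf sf fx]] := XJ x (mem_head _ _).
exists (f :: G) => [g|c]; rewrite inE => /orP[/eqP ->|] //; first exact: GJ.
  by exists f; split=> //; apply: sub_ideal_gen; apply: mem_head.
move/XG; apply: lead_ideal_mono; apply: ideal_gen_mono => g gG.
by rewrite /= inE gG orbT.
Qed.

Theorem noetherian_poly : noetherian S -> noetherian {poly S}.
Proof.
move=> noeS J idJ.
have idL m := lead_ideal_ideal m idJ.
pose L : set S := \bigcup_m lead_ideal J m.
have idLL : ideal L.
  split=> [|a b [m _ fa] [n _ fb]|a b [m _ fb]].
  - by exists 0%N => //; apply: ideal0.
  - exists (m + n)%N => //; apply: idealD => //.
      exact: (lead_ideal_le idJ (leq_addr _ _)).
    exact: (lead_ideal_le idJ (leq_addl _ _)).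
  - by exists m => //; apply: idealMl.
have [D stat] : exists D, forall m, lead_ideal J m `<=` lead_ideal J D.
  have [X LX] := noeS _ idLL.
  suff [D XD] : exists D, forall x, x \in X -> lead_ideal J D x.
    exists D => m c Lc; have : L c by exists m.
    by rewrite LX; apply: ideal_gen_sub.
  have: forall x, x \in X -> L x.
    by move=> x xX; rewrite LX; apply: sub_ideal_gen.
  elim: X {LX} => [|x X IH] XU; first by exists 0%N.
  have [|n Xn] := IH; first by move=> y yX; apply: XU; rewrite inE yX orbT.
  have [m _ xm] := XU x (mem_head _ _).
  exists (m + n)%N => y; rewrite inE => /orP[/eqP ->|/Xn yn].
    exact: (lead_ideal_le idJ (leq_addr _ _)).
  exact: (lead_ideal_le idJ (leq_addl _ _)).
have [G GJ GD] : exists2 G : seq {poly S}, (forall g, g \in G -> J g) &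
    forall m, (m < D.+1)%N ->
      lead_ideal J m `<=` lead_ideal (ideal_gen [set g | g \in G]) m.
  elim: D.+1 => [|k [G GJ Gk]]; first by exists [::].
  have [X LX] := noeS _ (idL k).
  have [|G' G'J XG'] := @lead_ideal_generators J X k idJ.
    by move=> c cX; rewrite LX; apply: sub_ideal_gen.
  exists (G ++ G') => [g|m]; first by rewrite mem_cat => /orP[/GJ|/G'J].
  rewrite ltnS leq_eqVlt => /orP[/eqP ->|/Gk mk].
    rewrite LX; apply: ideal_gen_sub.
      exact/lead_ideal_ideal/ideal_gen_ideal.
    move=> c /XG'; apply: lead_ideal_mono; apply: ideal_gen_mono => g gG.
    by rewrite /= mem_cat gG orbT.
  apply: subset_trans mk _; apply: lead_ideal_mono.
  apply: ideal_gen_mono => g gG.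
  by rewrite /= mem_cat gG.
exists G; have GJ' : ideal_gen [set g | g \in G] `<=` J by apply: ideal_gen_sub.
apply/seteqP; split=> //.
exact: (sub_of_lead_ideal idJ (ideal_gen_ideal _) GJ' GD stat).
Qed.

End HilbertBasis.

(** * The Rees algebra and finiteness of the asymptotic primes *)

Section Rees.
Variable A : comNzRingType.
Variable I : set A.
Hypothesis idI : ideal I.
Implicit Types (f g : {poly A}) (a b x y : A).

(** The Rees algebra of I, as a subset of the polynomials in t over A. *)
Definition rees : set {poly A} := [set f | forall i, ideal_pow I i f`_i].

(** With k = 0 the Rees algebra is closed under products; with k = 1 the
    extension of I to the Rees algebra is an ideal of it. *)
Lemma reesM_shift f g k : rees f -> (forall i, ideal_pow I (k + i) g`_i) ->
  forall i, ideal_pow I (k + i) (f * g)`_i.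
Proof.
move=> Rf Rg i; rewrite coefM; apply: ideal_sum => [|j _].
  exact: ideal_pow_ideal.
have -> : (k + i = j + (k + (i - j)))%N.
  by rewrite addnCA subnKC // -ltnS.
exact: ideal_powD.
Qed.

Lemma reesM f g : rees f -> rees g -> rees (f * g).
Proof. exact: (@reesM_shift f g 0). Qed.

Lemma reesC a : rees a%:P.
Proof.
by case=> [//|i]; rewrite coefC; apply: ideal0; apply: ideal_pow_ideal.
Qed.

Lemma reesD f g : rees f -> rees g -> rees (f + g).
Proof.
by move=> Rf Rg i; rewrite coefD; apply: idealD; [exact: ideal_pow_ideal|..].
Qed.

Lemma reesZX x : I x -> rees (x *: 'X).
Proof.
move=> Ix i; rewrite coefZ coefX; case: eqP => [->|_].
  exact: (@ideal_powS _ I 0 x).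
by rewrite mulr0; apply: ideal0; apply: ideal_pow_ideal.
Qed.

(** S is the polynomial ring over A with one variable for each x in X, iota the
    inclusion of the constants, and psi the A-morphism into the Rees algebra
    that sends the variable of x to xt. It is onto when X generates I
    ([rees_graded_surj]). *)
Lemma rees_presentation (X : seq A) :
  noetherian A -> (forall x, x \in X -> I x) ->
  exists (S : comNzRingType) (iota : {rmorphism A -> S})
         (psi : {rmorphism S -> {poly A}}),
    [/\ noetherian S, forall a, psi (iota a) = a%:P, forall s, rees (psi s) &
        forall x, x \in X -> exists s, psi s = x *: 'X].
Proof.
move=> noeA; elim: X => [|x X IH] XI.
  exists A, (idfun : {rmorphism A -> A}), (polyC : {rmorphism A -> {poly A}}).
  by split=> //; apply: reesC.
have [|S [iota [psi [noeS psiC psiR psiX]]]] := IH.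
  by move=> y yX; apply: XI; rewrite inE yX orbT.
have cx : commr_rmorph psi (x *: 'X) by move=> s; apply: mulrC.
exists {poly S}, (polyC \o iota : {rmorphism A -> {poly S}}), (horner_morph cx).
split.
- exact: noetherian_poly.
- by move=> a /=; rewrite horner_morphC.
- elim/poly_ind => [|p s IHp]; first by rewrite rmorph0; apply: (reesC 0).
  rewrite rmorphD rmorphM /= horner_morphC horner_morphX; apply: reesD => //.
  by apply: reesM => //; apply: reesZX; apply: XI; apply: mem_head.
- move=> y; rewrite inE => /orP[/eqP ->|/psiX[s <-]].
    by exists 'X; exact: horner_morphX.
  by exists s%:P; exact: horner_morphC.
Qed.

Lemma rees_graded_surj (X : seq A) (S : comNzRingType)
    (iota : {rmorphism A -> S}) (psi : {rmorphism S -> {poly A}}) :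
  I = ideal_gen [set x | x \in X] -> (forall a, psi (iota a) = a%:P) ->
  (forall x, x \in X -> exists s, psi s = x *: 'X) ->
  forall n y, ideal_pow I n y -> exists s, psi s = y *: 'X^n.
Proof.
move=> IX psiC psiX.
have idP n : ideal [set y | exists s, psi s = y *: 'X^n].
  split=> [|a b [s sa] [t tb]|a b [s sb]].
  - by exists 0; rewrite rmorph0 scale0r.
  - by exists (s + t); rewrite rmorphD /= sa tb scalerDl.
  - by exists (iota a * s); rewrite rmorphM /= sb psiC mul_polyC scalerA.
elim=> [|n IH] y.
  by move=> _; exists (iota y); rewrite psiC expr0 alg_polyC.
move: y; apply: (ideal_powS_sub (idP n.+1)) => a b Ia /IH[s sb].
have [t ta] : exists t, psi t = a *: 'X.
  by move: a Ia; rewrite IX; apply: (ideal_gen_sub (idP 1%N)).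
exists (t * s); rewrite rmorphM /= sb ta exprS.
by rewrite -scalerAl -scalerAr scalerA.
Qed.

(** Every annihilator prime of A/I^n is one of I^k/I^(k+1) for some k < n. *)
Lemma ann_prime_graded n y : prime_ideal (ann (ideal_pow I n) y) ->
  exists k z, [/\ (k < n)%N, ideal_pow I k z &
                  ann (ideal_pow I n) y = ann (ideal_pow I k.+1) z].
Proof.
elim: n => [|n IH] py; first by case: py => _ [].
have [[a [Ia ->]]|e] :=
    ann_prime_split (ideal_pow_ideal _ _) (@ideal_powS_le _ I n) py.
  by exists n, (a * y).
rewrite e in py *; have [k [z [kn Iz ->]]] := IH py.
by exists k, z; rewrite ltnS ltnW.
Qed.

(** The annihilator in A of the class of z in I^k/I^(k+1) is the contraction of
    the annihilator of the class of z t^k modulo the extension of I to the Rees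
    algebra; its primes are therefore contracted from the finitely many
    associated primes of that ideal. *)
Lemma Ass_star_finite_nz : noetherian A ->
  exists Ps : seq (set A),
    forall q : spec A, Ass_star I q -> (q : set A) \in Ps.
Proof.
move=> noeA; have [X IX] := noeA I idI.
have XI x : x \in X -> I x by move=> xX; rewrite IX; apply: sub_ideal_gen.
have [S [iota [psi [noeS psiC psiR psiX]]]] := rees_presentation noeA XI.
have surj := rees_graded_surj IX psiC psiX.
pose J : set S := [set s | forall i, ideal_pow I i.+1 (psi s)`_i].
have idJ : ideal J.
  split=> [i|s t Js Jt i|s t Jt i].
  - by rewrite rmorph0 coef0; apply: ideal0; apply: ideal_pow_ideal.
  - rewrite rmorphD coefD; apply: (idealD (ideal_pow_ideal I i.+1)).
      exact: Js.
    exact: Jt.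
  - by rewrite rmorphM; apply: (@reesM_shift _ _ 1).
have [Ps PsP] := ann_primes_finite noeS idJ.
exists [seq iota @^-1` P | P <- Ps] => q [n /= n0 [y qy]].
have [_ q1 qM] := svalP q; rewrite -/(prime_set q) in q1 qM.
have [|k [z [kn Iz e]]] := @ann_prime_graded n y.
  by rewrite /ann -qy; case: (q).
have {}qz : (q : set A) = ann (ideal_pow I k.+1) z by rewrite -e.
have [s sz] := surj k z Iz.
have JP a : J (iota a * s) <-> (q : set A) a.
  rewrite qz; have E : psi (iota a * s) = (a * z) *: 'X^k.
    by rewrite rmorphM /= psiC sz mul_polyC scalerA.
  split=> [/(_ k)|az i]; first by rewrite E coefZ coefXn eqxx mulr1.
  rewrite E coefZ coefXn; case: eqP => [->|_]; first by rewrite mulr1.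
  by rewrite mulr0; apply: ideal0; apply: ideal_pow_ideal.
(* (J : s) contracts to q but need not be prime; enlarge it to a prime that
   still misses the image of the complement of q. *)
have [|||b [pb Tb]] :=
    @ann_prime_avoiding _ noeS J (iota @` [set a | ~ (q : set A) a]) s idJ.
- by exists 1; rewrite ?rmorph1.
- move=> _ _ [a na <-] [b nb <-]; exists (a * b); rewrite ?rmorphM //.
  by move=> /qM[].
- by move=> _ [a na <-] /JP.
apply/mapP; exists (ann J (b * s)); first exact: PsP.
apply/seteqP; split=> a.
  move=> /JP Ja; change (J (iota a * (b * s))).
  by rewrite mulrCA; apply: (idealMl _ idJ).
by move=> Ja; apply: contrapT => na; apply: (Tb (iota a)) => //; exists a.
Qed.

End Rees.

Lemma Ass_star_finite (A : comPzRingType) (I : set A) :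
  noetherian A -> ideal I ->
  exists Ps : seq (set A),
    forall q : spec A, Ass_star I q -> (q : set A) \in Ps.
Proof.
move=> noeA idI; have [nz|z] := pselect (1 != 0 :> A).
  pose A' : comNzRingType := HB.pack (GRing.ComPzRing.sort A)
    (GRing.PzSemiRing_isNonZero.Build A nz).
  exact: (@Ass_star_finite_nz A').
(* The zero ring has no prime ideal. *)
exists [::] => q _; case: (svalP q) => idq q1 _; case: q1.
by move/negP: z; rewrite negbK => /eqP ->; apply: ideal0.
Qed.

(** * Localization, minimal primes and saturation *)

Section Symbolic.
Variable A : comPzRingType.
Implicit Types (I J K N : set A) (p q : spec A) (a b x y u : A).

Lemma spec_ideal p : ideal p. Proof. by case: (svalP p). Qed.

Lemma spec1 p : ~ (p : set A) 1. Proof. by case: (svalP p). Qed.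

Lemma specM p a b : (p : set A) (a * b) -> (p : set A) a \/ (p : set A) b.
Proof. by case: (svalP p) => _ _; apply. Qed.

Lemma specX p a n : (p : set A) (a ^+ n) -> (p : set A) a.
Proof.
elim: n => [/spec1 //|n IH]; rewrite exprS.
by move=> /specM[//|]; apply: IH.
Qed.

Lemma spec_ideal_pow I p n : ideal_pow I n `<=` p -> I `<=` p.
Proof. by move=> Ip a Ia; apply: (@specX p a n); apply/Ip/ideal_powX. Qed.

Lemma bigcap_spec_ideal (D : set (spec A)) :
  ideal (\bigcap_(p in D) (p : set A)).
Proof.
split=> [p _|a b Da Db p Dp|a b Db p Dp]; first exact: (ideal0 (spec_ideal p)).
  by apply: (idealD (spec_ideal p)); [exact: Da | exact: Db].
by apply: (idealMl _ (spec_ideal p)); exact: Db.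
Qed.

Lemma loc_contrP p J a : ideal J ->
  loc_contr p J a <-> exists2 u, ~ (p : set A) u & J (u * a).
Proof.
move=> idJ; pose pi (f : loc_frac p) := (\pi_(localization p) f)%qT.
split; last first.
  move=> [u nu Ju]; have hu : u \notin (p : set A) by rewrite notin_setE.
  rewrite /loc_contr /=.
  have -> : to_loc p a = pi (mkfrac 1 hu) * to_loc p (u * a).
    change (to_loc p a = loc_mul (pi (mkfrac 1 hu)) (to_loc p (u * a))).
    rewrite /to_loc loc_mulE; apply/eqP/loc_piP; exists 1; first exact: den1.
    by rewrite /=; ring.
  apply: (idealMl _ (ideal_gen_ideal _)).
  by apply: sub_ideal_gen; exists (u * a).
(* The extension of J to the localization consists of the fractions j/u. *)
pose E : set (localization p) :=
  [set z | exists j u (hu : u \notin (p : set A)), J j /\ z = pi (mkfrac j hu)].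
have idE : ideal E.
  split.
  - by exists 0, 1, (den1 p); split; first exact: ideal0.
  - move=> _ _ [j [u [hu [Jj ->]]]] [k [v [hv [Jk ->]]]].
    exists (j * v + k * u), (u * v), (denM hu hv); split.
      by apply: idealD => //; apply: idealMr.
    transitivity (pi (addl_frac (mkfrac j hu) (mkfrac k hv))).
      exact: loc_addE.
    by congr (pi _); apply: val_inj.
  - elim/quotW=> [[[b v] /= hv]] _ [j [u [hu [Jj ->]]]].
    exists (b * j), (v * u), (denM hv hu); split; first exact: idealMl.
    transitivity (pi (mull_frac (mkfrac b hv) (mkfrac j hu))).
      exact: loc_mulE.
    by congr (pi _); apply: val_inj.
rewrite /loc_contr /= => Ja.
have {Ja} : E (to_loc p a).
  apply: (ideal_gen_sub idE) Ja => _ [j Jj <-].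
  by exists j, 1, (den1 p).
move=> [j [u [hu [Jj /eqP/loc_piP[v hv /=]]]]] e.
exists (v * u); first by move: (denM hv hu); rewrite notin_setE.
have -> : v * u * a = v * j by rewrite -[j]mulr1 -e; ring.
exact: idealMl.
Qed.

(** An element outside a prime p can be found in all the members, not
    contained in p, of a finite family of ideals. *)
Lemma prime_avoid_finite p (Ps : seq (set A)) :
  exists2 u, ~ (p : set A) u &
    forall P, P \in Ps -> ideal P -> ~ P `<=` p -> P u.
Proof.
elim: Ps => [|P Ps [u nu Pu]]; first by exists 1 => //; exact: spec1.
have [[idP nP]|no] := pselect (ideal P /\ ~ P `<=` p); last first.
  exists u => // Q; rewrite inE => /orP[/eqP -> idQ nQ|/Pu //].
  by case: no.
have [v Pv nv] : exists2 v, P v & ~ (p : set A) v.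
  apply: contrapT => no; apply: nP => v Pv; apply: contrapT => nv.
  by apply: no; exists v.
exists (v * u) => [/specM[]//|Q]; rewrite inE => /orP[/eqP -> _ _|QPs idQ nQ].
  exact: idealMr.
by apply: idealMl => //; apply: Pu.
Qed.

Lemma Ass_sub J p : ideal J -> Ass J p -> J `<=` p.
Proof. by move=> idJ [y ->] a Ja; apply: idealMr. Qed.

(** A prime minimal over I contains no prime over I that fails to be minimal. *)
Lemma Min_not_sub I p q : Min I p -> I `<=` q -> ~ Min I q ->
  ~ (q : set A) `<=` p.
Proof.
move=> [Ip minp] Iq nq qp; apply: nq; have e := minp q Iq qp.
split=> // r Ir; rewrite e; exact: minp.
Qed.

(** An element x of p satisfies x^n u in I for some n and some u outside p:
    otherwise a prime over I would avoid x and the complement of p, hence would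
    be strictly contained in p. Then xu lies in the radical of I, and u does
    not. *)
Lemma regular_notin_Min I p x : noetherian A -> ideal I -> Min I p ->
  regular_mod (radical I) x -> ~ (p : set A) x.
Proof.
move=> noeA idI [Ip minp] regx px.
have [[n [u nu Iu]]|no] :=
    pselect (exists n, exists2 u, ~ (p : set A) u & I (x ^+ n * u)).
  have /regx[m Im] : radical I (x * u).
    exists n.+1; rewrite exprMn exprS exprS.
    have -> : x * x ^+ n * (u * u ^+ n) = (x * u ^+ n) * (x ^+ n * u) by ring.
    exact: idealMl.
  by apply: nu; apply: (@specX p u m); apply: Ip.
pose T : set A :=
  [set t | exists n, exists2 u, ~ (p : set A) u & t = x ^+ n * u].
have [||| b [pb Tb]] := @ann_prime_avoiding A noeA I T 1 idI.
- by exists 0%N, 1; [exact: spec1 | rewrite expr0 mulr1].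
- move=> _ _ [n [u nu ->]] [m [v nv ->]]; exists (n + m)%N, (u * v).
    by move=> /specM[].
  by rewrite exprD; ring.
- by move=> _ [n [u nu ->]]; rewrite mulr1 => Iu; apply: no; exists n, u.
pose q : spec A := exist _ _ pb.
have Iq : I `<=` q by move=> a Ia; apply: (idealMr _ idI).
have qp : (q : set A) `<=` p.
  move=> a qa; apply: contrapT => na; apply: (Tb a) => //.
  by exists 0%N, a => //; rewrite expr0 mul1r.
apply: (Tb x).
  by exists 1%N, 1; [exact: spec1 | rewrite expr1 mulr1].
by move: px; rewrite -(minp q Iq qp).
Qed.

Lemma sat_pow_anti I s K L : K `<=` L -> sat_pow I s L `<=` sat_pow I s K.
Proof.
move=> KL a [t t0 La]; exists t => // b Kb.
by apply: La; apply: ideal_pow_mono Kb.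
Qed.

Lemma primary_radical_prime (Q : set A) :
  primary_ideal Q -> prime_ideal (radical Q).
Proof.
move=> [idQ Q1 QM]; split.
- split=> [|a b [n Qa] [m Qb]|a b [n Qb]].
  + by exists 1%N; rewrite expr1; apply: ideal0.
  + exists (n + m)%N; rewrite exprDn; apply: ideal_sum => // i _.
    rewrite -mulr_natr; apply: idealMr => //.
    have [ni|mi] := leqP m i.
      by apply: idealMl => //; rewrite -(subnK ni) exprD; apply: idealMl.
    apply: idealMr => //; have le : (n <= n + m - i)%N.
      by rewrite -addnBA ?leq_addr // ltnW.
    by rewrite -(subnK le) exprD; apply: idealMl.
  + by exists n; rewrite exprMn; apply: idealMl.
- by move=> [n]; rewrite expr1n.
- move=> a b [n]; rewrite exprMn => /QM[Qa|[m Qb]]; first by left; exists n.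
  by right; exists (n * m)%N; rewrite exprM.
Qed.

Section Powers.
Variables (I : set A) (s : nat).
Hypotheses (noeA : noetherian A) (idI : ideal I) (s_gt0 : (0 < s)%N).
Let J := ideal_pow I s.
Let idJ : ideal J := ideal_pow_ideal I s.

Lemma min_symb_powP a : min_symb_pow I s a <->
  forall p, Min I p -> exists2 u, ~ (p : set A) u & J (u * a).
Proof.
by split=> h p /h; move/(loc_contrP p a idJ).
Qed.

(** Saturating by a set K contained in no minimal prime of I stays inside the
    symbolic power. *)
Lemma sat_pow_sub_min K :
  (forall p, Min I p -> exists2 u, ~ (p : set A) u & K u) ->
  sat_pow I s K `<=` min_symb_pow I s.
Proof.
move=> KP a [t _ Ka]; apply/min_symb_powP => p /KP[u nu Ku].
exists (u ^+ t); first by move/specX.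
by rewrite mulrC; apply: Ka; apply: ideal_powX.
Qed.

(** If no power of an element f of the intersection killed a modulo J, some
    associated prime (J : y) with y in (a) would not contain f, hence would be
    minimal over I; but for each minimal prime, some element outside it kills a
    modulo J. *)
Lemma min_symb_pow_sub_sat :
  min_symb_pow I s `<=`
    sat_pow I s (\bigcap_(p in Ass J `\` Min I) (p : set A)).
Proof.
move=> a /min_symb_powP Ma; set K := \bigcap_(p in _) _.
have idK : ideal K by apply: bigcap_spec_ideal.
have radK : K `<=` radical (ann J a).
  move=> f Kf; apply: contrapT => nf.
  have [||| b [pb Tb]] :=
      @ann_prime_avoiding A noeA J [set t | exists n, t = f ^+ n] a idJ.
  - by exists 0%N; rewrite expr0.
  - by move=> _ _ [n ->] [m ->]; exists (n + m)%N; rewrite exprD.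
  - by move=> _ [n ->] Jf; apply: nf; exists n.
  pose q : spec A := exist _ _ pb.
  have Aq : Ass J q by exists (b * a).
  have Mq : Min I q.
    apply: contrapT => nM; apply: (Tb f); first by exists 1%N; rewrite expr1.
    exact: (Kf q).
  have [u nu Ju] := Ma q Mq; apply: nu; rewrite /q /= /ann /= mulrCA.
  exact: (idealMl _ idJ).
have [t tJ] := sub_radical_pow noeA (ann_ideal a idJ) idK radK.
(* The exponent of a saturation is positive, whereas t may be 0. *)
exists t.+1 => // b /ideal_powS_le /tJ; rewrite /ann /= mulrC.
exact.
Qed.

(** Only finitely many primes are asymptotic, and a minimal prime of I contains
    none of the others; hence it does not contain their intersection. *)
Lemma asymptotic_notin_Min p : Min I p -> exists2 u, ~ (p : set A) u &
  (\bigcap_(q in Ass_star I `\` Min I) (q : set A)) u.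
Proof.
move=> Mp; have [Ps PsP] := Ass_star_finite noeA idI.
have [u nu Pu] := prime_avoid_finite p Ps; exists u => // q [Aq nMq].
apply: Pu; [exact: PsP | exact: spec_ideal|].
apply: (Min_not_sub Mp) => //; have [n _ An] := Aq.
by apply: (@spec_ideal_pow I q n); apply: Ass_sub An; apply: ideal_pow_ideal.
Qed.

(** A component whose radical is not minimal over I is contained in no minimal
    prime p of I, so an element u outside p can be chosen in all of them. *)
Lemma min_symb_pow_decomp n (Q : 'I_n -> set A) :
  (forall i, primary_ideal (Q i)) -> J = \bigcap_i Q i ->
  min_symb_pow I s =
    \bigcap_(i in [set i | exists2 p, Min I p & radical (Q i) = p]) Q i.
Proof.
move=> prQ JQ; have JQi i : J `<=` Q i by rewrite JQ => a; apply.
have idQ i : ideal (Q i) by case: (prQ i).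
apply/seteqP; split=> a.
  move=> /min_symb_powP Ma i [p Mp Qp]; have [u nu /JQi] := Ma p Mp.
  have [_ _ QM] := prQ i; rewrite mulrC => /(_ i)/QM[//|].
  by rewrite Qp.
move=> Qa; apply/min_symb_powP => p Mp.
have [u nu Pu] := prime_avoid_finite p [seq Q i | i <- enum 'I_n].
exists u => //; rewrite JQ => i _.
have [Mi|nMi] := pselect (exists2 p, Min I p & radical (Q i) = p).
  by apply: idealMl => //; apply: Qa.
apply: idealMr => //; apply: Pu => //; first by apply: map_f; rewrite mem_enum.
pose q : spec A := exist _ _ (primary_radical_prime (prQ i)).
have Iq : I `<=` q.
  by move=> b Ib; exists s; apply: JQi; apply: ideal_powX.
move=> Qp; apply: (@Min_not_sub I p q) => //.
  by move=> Mq; apply: nMi; exists q.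
by move=> b [m /Qp /specX].
Qed.

End Powers.

End Symbolic.

Theorem lemma2p1 (A : comPzRingType) (noethA : noetherian A)
    (I : set A) (idI : ideal I) (s : nat) (s_gt0 : (0 < s)%N) :
  let K := \bigcap_(p in Ass_star I `\` Min I) (p : set A) in
  let Ks := \bigcap_(p in Ass (ideal_pow I s) `\` Min I) (p : set A) in
  [/\ min_symb_pow I s = sat_pow I s K,
      sat_pow I s K = sat_pow I s Ks,
      (forall x : A, K x ->
         (Ass_star I `\` Min I !=set0 -> regular_mod (radical I) x) ->
         (Ass_star I `\` Min I = set0 -> x = 1) ->
         sat_pow I s Ks = sat_pow I s (ideal_gen [set x])) &
      (forall (n : nat) (Q : 'I_n -> set A),
         irredundant_primary_decomp (ideal_pow I s) Q ->
         min_symb_pow I s =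
           \bigcap_(i in [set i | exists2 p, Min I p & radical (Q i) = p]) Q i)].
Proof.
move=> K Ks.
have KKs : K `<=` Ks by move=> a Ka p [Ap nMp]; apply: Ka; split=> //; exists s.
have KM : sat_pow I s K `<=` min_symb_pow I s.
  by apply: sat_pow_sub_min => p; apply: asymptotic_notin_Min.
have MKs : min_symb_pow I s `<=` sat_pow I s Ks by apply: min_symb_pow_sub_sat.
have KsK : sat_pow I s Ks `<=` sat_pow I s K by apply: sat_pow_anti.
have eK : sat_pow I s K = sat_pow I s Ks.
  by apply/seteqP; split=> // a /KM /MKs.
have eM : min_symb_pow I s = sat_pow I s Ks.
  by apply/seteqP; split=> // a /KsK /KM.
split=> //; first by rewrite eK.
  move=> x Kx xreg x1; apply/seteqP; split.
    apply: sat_pow_anti; apply: (ideal_gen_sub (bigcap_spec_ideal _)) => _ ->.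
    exact: KKs.
  rewrite -eM; apply: sat_pow_sub_min => p Mp; exists x; last first.
    exact: sub_ideal_gen.
  have [|] := pselect (Ass_star I `\` Min I !=set0).
    by move/xreg; apply: regular_notin_Min.
  by move/nonemptyPn/x1 => ->; apply: spec1.
by move=> n Q [prQ JQ _]; apply: min_symb_pow_decomp.
Qed.
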